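(* Let $C$ be a triply even binary code of length $48$ belonging to family (A) or family (B), where (A) consists of the codes whose set of occurring weights is exactly $\{0,16,24,32,48\}$ and whose dual code $C^{\perp}$ has minimum weight $4$, and (B) consists of the codes whose set of occurring weights is exactly $\{0,24,48\}$ and whose dual code $C^{\perp}$ has minimum weight $2$. Let $D_w$ and $D_w^{\perp}$ denote the support designs of weight $w$ of $C$ and of $C^{\perp}$, respectively. (1) For all $w\neq 0$ occurring in $C$ (respectively in $C^{\perp}$), $D_w$ (respectively $D_w^{\perp}$) is a $1$-design. (2) If $C$ is in family (A) and $\dim C\neq 13$, then $D_6^{\perp}$ is a $2$-design but is not a $3$-design, and likewise $D_{42}^{\perp}$ is a $2$-design but is not a $3$-design. In all other cases, $D_w$ and $D_w^{\perp}$ are not $2$-designs. That is, for every code $C$ in (A) or (B) and every $w$ with $0<w<48$: if $w$ occurs in $C$ then $D_w$ is not a $2$-design; and if $w$ occurs in $C^{\perp}$ then $D_w^{\perp}$ is not a $2$-design, except when $C$ is in (A), $\dim C\ne 13$ and $w\in\{6,42\}$.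
   Context: A binary code of length $n$ is a linear subspace of $\mathbb{F}_2^n$, and $C^{\perp}$ is its dual with respect to the standard inner product. The weight of a vector is its number of nonzero coordinates; a weight occurs in a code if some codeword has that weight; the minimum weight of a code is the smallest weight of a nonzero codeword. A code is triply even if the weight of every codeword is divisible by $8$. For a weight $w>0$ occurring in a code of length $n$, the support design of weight $w$ has the $n$ coordinate indices as points, and as blocks the supports (sets of indices of nonzero coordinates) of all codewords of weight $w$. A $t$-$(v,k,\lambda)$ design ($t$-design for short) is a set of $v$ points with a collection of $k$-element subsets (blocks) such that any $t$ points are contained in precisely $\lambda$ blocks. Up to equivalence (coordinate permutation), family (A) consists of $42$ codes: $1,5,16,14,4,1,1$ codes of dimensions $7,8,9,10,11,12,13$ respectively. Family (B) consists of $4$ codes, one in each of the dimensions $2,3,4,5$. *)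

(* Defs.v *)
From HB Require Import structures.
From mathcomp Require Import all_boot all_order all_algebra.

Set Implicit Arguments.
Unset Strict Implicit.
Unset Printing Implicit Defensive.

Import GRing.Theory.
Local Open Scope ring_scope.

Notation code n := {vspace 'rV['F_2]_n}.

Definition supp n (x : 'rV['F_2]_n) : {set 'I_n} := [set i | x 0 i != 0].

Definition wt n (x : 'rV['F_2]_n) : nat := #|supp x|.

(* The intersection, over all codewords u, of the kernels of v |-> v u^T;
   see mem_dual. *)
Definition dual n (C : code n) : code n :=
  (\bigcap_(u : 'rV['F_2]_n | u \in C)
     lker (linfun (mulmxr u^T : 'rV['F_2]_n -> 'M['F_2]_1)))%VS.

Lemma mem_dual n (C : code n) (v : 'rV['F_2]_n) :
  reflect (forall u, u \in C -> \sum_(i < n) v 0 i * u 0 i = 0)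
          (v \in dual C).
Proof.
have dotE (u : 'rV['F_2]_n) :
    (v \in lker (linfun (mulmxr u^T : 'rV['F_2]_n -> 'M['F_2]_1)))
    = (\sum_(i < n) v 0 i * u 0 i == 0).
  rewrite memv_ker lfunE /=; apply/eqP/eqP => [/matrixP/(_ 0 0)|e0].
    rewrite !mxE => e0; rewrite -[RHS]e0.
    by apply: eq_bigr => i _; rewrite mxE.
  apply/matrixP => i j; rewrite !ord1 !mxE -[RHS]e0.
  by apply: eq_bigr => k _; rewrite mxE.
rewrite /dual memvE; apply: (iffP subv_bigcapP) => h u Cu.
  by apply/eqP; rewrite -dotE memvE h.
by rewrite -memvE dotE; apply/eqP/h.
Qed.

Definition occurs n (C : code n) (w : nat) : bool :=
  [exists x : 'rV['F_2]_n, (x \in C) && (wt x == w)].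

Definition has_min_weight n (C : code n) (d : nat) : Prop :=
  (exists x : 'rV['F_2]_n, [/\ x \in C, x != 0 & wt x = d]) /\
  (forall x : 'rV['F_2]_n, x \in C -> x != 0 -> (d <= wt x)%N).

Definition triply_even n (C : code n) : Prop :=
  forall x : 'rV['F_2]_n, x \in C -> (8 %| wt x)%N.

(* Over F_2 a vector is determined by its support, so a set of blocks (rather
   than a multiset) records every codeword of weight w exactly once. *)
Definition support_design n (C : code n) (w : nat) : {set {set 'I_n}} :=
  [set supp x | x : 'rV['F_2]_n & (x \in C) && (wt x == w)].

Definition is_design (T : finType) (t v k lambda : nat)
    (B : {set {set T}}) : Prop :=
  [/\ #|T| = v,
      (forall b : {set T}, b \in B -> #|b| = k)
    & forall S : {set T}, #|S| = t ->
        #|[set b in B | S \subset b]| = lambda].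

Definition is_t_design (T : finType) (t : nat) (B : {set {set T}}) : Prop :=
  exists v k lambda : nat, is_design t v k lambda B.

Definition familyA (C : code 48) : Prop :=
  [/\ triply_even C,
      (forall w : nat, occurs C w = (w \in [:: 0; 16; 24; 32; 48]%N))
    & has_min_weight (dual C) 4].

Definition familyB (C : code 48) : Prop :=
  [/\ triply_even C,
      (forall w : nat, occurs C w = (w \in [:: 0; 24; 48]%N))
    & has_min_weight (dual C) 2].

(* Main.v *)
From Stdlib Require Import ZArith.
Require Import Defs.
From mathcomp Require Import all_boot all_order all_algebra finfield.
From mathcomp Require Import ssrZ zify ring.

(** For a code C of length n, a weight w and a set T of coordinates, let
cov C w T be the number of codewords of weight w whose support contains T.
The support design of weight w is a t-design exactly when cov C w T takes the
same value on all T of size t (t_designP).  A MacWilliams identity for cov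
(dual_cov, dual_cov0, dual_cov1, dual_cov2) expresses cov (dual C) linearly
through cov C, the coefficients being built from those of (1 + y)^a (1 - y)^b.
Applied with |T| = 0, 1, 2, it carries the whole proof.
Differences of cov between two points, or between two pairs, play the part of
harmonic weight enumerators of degree 1 and 2.

Both families contain the all-one word, so complementation relates weights w
and 48 - w.  In family (A) only a = cov C 16 set0 and b = cov C 24 set0 are
unknown, and the absence of dual words of weight 2 gives 32 a = 3 |C| - 288.
Then

   |C| * #(dual words of weight 6) = 3008 (8192 - |C|),

which bounds the dimension by 13 and shows that weight 6 occurs in the dual
exactly when the dimension is not 13; a >= 1 bounds it by 7 from below.  So
the classification of the codes is replaced by seven possible values of |C|.

Points.  Vanishing of dual weight 2 at a single point p forces
3 cov C 16 {p} = a, hence every design of C is a 1-design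
(familyA_point_regular), and MacWilliams transports this to the dual code
(point_regular_dual).  In family (B) complementation alone suffices.

Pairs.  Once the one-point counts are constant, the difference d_w of
cov C w between two pairs transforms among differences only
(pair_diff_dual).  In family (A), d_32 = d_16 by complementation and
d_24 = - 2 d_16 because the dual has no word of weight 2, so each difference
for the dual at weight 2 + j is d_16 / |C| times a fixed integer
(familyA_pair_diff_dual).  That integer is the coefficient of y^j in
4 (1 - y^2)^14 ((1 + y)^16 + (1 - y)^16 - 2 (1 - y^2)^8); among the weights
that can occur in the dual it vanishes exactly at 2 + j = 6 and 42.  Hence D_6
and D_42 of the dual are 2-designs, whereas any other 2-design would force
d_16 = 0 for all pairs, that is, D_16 would be a 2-design, and then 47 would
divide a, which fails for all seven values of |C|.  In family (B) the integer
is the coefficient of y^j in 4 (1 - y^2)^22, nonzero for all even j <= 44, and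
D_24 is not a 2-design, again because of the prime 47.  Finally, a 3-design
with the parameters of D_6 or D_42 would need the prime 23 to divide
8192 / |C| - 1. *)

(** * The MacWilliams identity in product form *)

Section Macwilliams.

Set Implicit Arguments.
Unset Strict Implicit.

Import GRing.Theory.
Local Open Scope ring_scope.

(** The nontrivial additive character of F_2, with values in an arbitrary ring. *)
Definition chi (R : pzRingType) (a : 'F_2) : R := (-1) ^+ (a != 0).

Lemma F2_cases (a : 'F_2) : a = 0 \/ a = 1.
Proof. by case: a => [[|[|m]] h]; [left|right|] => //; apply: val_inj. Qed.

Lemma chiD (R : pzRingType) (a b : 'F_2) : chi R (a + b) = chi R a * chi R b.
Proof.
rewrite /chi; case: (F2_cases a) => ->; case: (F2_cases b) => ->;
  by rewrite ?addr0 ?add0r ?expr0 ?expr1 ?mulr1 ?mul1r ?mulrNN ?mulr1.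
Qed.

Definition dot n (v u : 'rV['F_2]_n) : 'F_2 := \sum_(i < n) v 0 i * u 0 i.

Lemma dotDr n (v u u' : 'rV['F_2]_n) : dot v (u + u') = dot v u + dot v u'.
Proof.
by rewrite /dot -big_split; apply: eq_bigr => i _; rewrite !mxE mulrDr.
Qed.

(** If some u0 in C is not orthogonal to v, translation by u0 exchanges the words
of C that are orthogonal to v with those that are not, so the signs cancel in
any ring, including rings where 2 is a zero divisor. *)
Lemma sum_chi_dot (R : pzRingType) n (C : code n) v :
  \sum_(u in C) chi R (dot v u) = if v \in dual C then #|C|%:R else 0.
Proof.
case: ifPn => [/mem_dual v_dual | v_ndual].
  rewrite -sum1_card natr_sum; apply: eq_bigr => u Cu.
  by rewrite /dot v_dual.
have [u0 Cu0 vu0] : exists2 u0, u0 \in C & dot v u0 = 1.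
  case: (pickP [pred u in C | dot v u != 0]) => [u /andP[Cu vu]|noU].
    by exists u => //; case: (F2_cases (dot v u)) vu => ->.
  case/negP: v_ndual; apply/mem_dual => u Cu.
  by have /= := noU u; rewrite Cu /= => /negbFE/eqP.
(* Translation by u0 matches the two halves of the sum with opposite signs. *)
rewrite (bigID (fun u => dot v u == 0)) /=.
rewrite [X in _ + X](reindex (fun u => u + u0)) /=; last first.
  by exists (fun u => u - u0) => u _; rewrite ?addrK ?subrK.
rewrite [X in _ + X](eq_bigl (fun u => (u \in C) && (dot v u == 0))); last first.
  move=> u; rewrite rpredDr // dotDr vu0; congr (_ && _).
  by case: (F2_cases (dot v u)) => ->.
rewrite -big_split big1 // => u /andP[_ /eqP vu].
by rewrite dotDr vu vu0 add0r /chi eqxx oner_eq0 /= expr1 subrr.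
Qed.

(** Poisson summation on F_2^n for a product function: the factor at i of its
Fourier transform is phi i 0 + chi (u_i) * phi i 1.  Letting the factors depend
on i is what allows some coordinates to be singled out later. *)
Lemma macwilliams (R : comNzRingType) n (C : code n)
    (phi : 'I_n -> 'F_2 -> R) :
  #|C|%:R * \sum_(v in dual C) \prod_i phi i (v 0 i)
  = \sum_(u in C) \prod_i (phi i 0 + chi R (u 0 i) * phi i 1).
Proof.
have fourier (u : 'rV['F_2]_n) i :
    phi i 0 + chi R (u 0 i) * phi i 1
    = \sum_(a : 'F_2) chi R (a * u 0 i) * phi i a.
  rewrite big_ord_recl big_ord1 (_ : ord0 = 0) // (_ : lift _ _ = 1); last exact: val_inj.
  by rewrite mul0r mul1r {2}/chi eqxx mul1r.
under [RHS]eq_bigr => u _.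
  under eq_bigr => i _ do rewrite fourier.
  rewrite bigA_distr_bigA; over.
rewrite exchange_big /= (reindex (fun v : 'rV['F_2]_n => [ffun i => v 0 i])) /=; last first.
  exists (fun f : {ffun 'I_n -> 'F_2} => \row_i f i) => [v _|f _].
    by apply/rowP => i; rewrite mxE ffunE.
  by apply/ffunP => i; rewrite ffunE mxE.
under [RHS]eq_bigr => v _.
  under eq_bigr => u _.
    under eq_bigr do rewrite ffunE.
    rewrite big_split /= -(big_morph _ (chiD R) (_ : chi R 0 = 1)); last by rewrite /chi eqxx.
    over.
  rewrite -mulr_suml sum_chi_dot; over.
rewrite mulr_sumr [LHS]big_mkcond /=; apply: eq_bigr => v _.
by case: ifP; rewrite ?mul0r.
Qed.

End Macwilliams.

(** * Codewords of given weight through a set of coordinates *)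

Section Coverage.

Set Implicit Arguments.
Unset Strict Implicit.

Import GRing.Theory.
Local Open Scope ring_scope.

Definition cov n (C : code n) (w : nat) (T : {set 'I_n}) : nat :=
  #|[set b in support_design C w | T \subset b]|.

Lemma supp_inj n : injective (@supp n).
Proof.
move=> x y /setP xy; apply/rowP => i.
have := xy i; rewrite !inE.
by case: (F2_cases (x 0 i)) => ->; case: (F2_cases (y 0 i)) => ->.
Qed.

(** Blocks and codewords correspond one to one because a binary vector is
determined by its support. *)
Lemma covE n (C : code n) w (T : {set 'I_n}) :
  cov C w T = #|[set x in C | (wt x == w) && (T \subset supp x)]|.
Proof.
rewrite /cov -(card_imset _ (@supp_inj n)); apply: eq_card => b.
rewrite !inE; apply/andP/imsetP => [[/imsetP[x xC ->] Tx]|[x]].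
  by exists x => //; rewrite inE; move: xC Tx; rewrite inE => /andP[-> ->].
rewrite inE => /and3P[xC xw Tx] ->; split=> //.
by apply: imset_f; rewrite inE xC.
Qed.

(** The Krawtchouk numbers: kraw a b j is the value at b of the Krawtchouk
polynomial of degree j for length a + b. *)
Definition kraw (R : comNzRingType) (a b j : nat) : R :=
  ((1 + 'X) ^+ a * (1 - 'X) ^+ b : {poly R})`_j.

(** Apply the product identity over R[X] to the function that weighs a coordinate
outside T by X^(v_i) and, inside T, keeps only v_i = 1.  The coefficient of X^j
then counts the dual words of weight |T| + j through T. *)
Lemma dual_cov (R : comNzRingType) n (C : code n) (T : {set 'I_n}) j :
  #|C|%:R * (cov (dual C) (#|T| + j) T)%:R
  = \sum_(u in C) (-1) ^+ #|supp u :&: T| *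
      kraw R #|~: (supp u :|: T)| #|supp u :\: T| j.
Proof.
pose phi i (a : 'F_2) : {poly R} :=
  if i \in T then (a != 0)%:R else if a == 0 then 1 else 'X.
have phi_dual (v : 'rV['F_2]_n) :
    \prod_i phi i (v 0 i)
    = if T \subset supp v then 'X^(wt v - #|T|) else 0.
  case: ifPn => [Tv|/subsetPn[i iT]]; last first.
    by rewrite inE negbK => vi; rewrite (bigD1 i) //= /phi iT vi /= mul0r.
  rewrite (bigID (mem T)) /= big1 ?mul1r => [|i iT]; last first.
    by have := subsetP Tv i iT; rewrite /phi iT inE => ->.
  rewrite /wt -(cardsDS Tv) -prodr_const big_mkcond /= [RHS]big_mkcond.
  apply: eq_bigr => i _; rewrite !inE /phi; case: (i \in T) => //=.
  by case: eqP.
have phi_hat (u : 'rV['F_2]_n) :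
    \prod_i (phi i 0 + chi _ (u 0 i) * phi i 1)
    = ((-1) ^+ #|supp u :&: T|) *
      ((1 + 'X) ^+ #|~: (supp u :|: T)| * (1 - 'X) ^+ #|supp u :\: T|).
  rewrite -!prodr_const.
  rewrite [X in X * _]big_mkcond [X in _ * (X * _)]big_mkcond.
  rewrite [X in _ * (_ * X)]big_mkcond -!big_split /=.
  apply: eq_bigr => i _; rewrite !inE /phi /chi.
  case: (i \in T); case: (F2_cases (u 0 i)) => -> //=;
    rewrite ?eqxx ?oner_eq0 /= ?expr1 ?expr0 ?mulN1r ?mul1r ?mulr1 ?add0r //.
have := macwilliams C phi.
under [X in _ = X]eq_bigr => u _ do rewrite phi_hat.
under [X in _ * X]eq_bigr => v _ do rewrite phi_dual.
move=> /(congr1 (fun p : {poly R} => p`_j)).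
rewrite -polyC_natr coefCM !coef_sum => h.
transitivity (#|C|%:R *
  \sum_(v in dual C) (if T \subset supp v then 'X^(wt v - #|T|) else 0 : {poly R})`_j).
  congr (_ * _); rewrite covE -sum1_card natr_sum big_mkcond [RHS]big_mkcond /=.
  apply: eq_bigr => v _; rewrite inE; case: (v \in dual C) => //=.
  case: (boolP (T \subset supp v)) => [Tv|_]; last by rewrite andbF coef0.
  rewrite andbT coefXn.
  have := subset_leq_card Tv; rewrite -/(wt v) => le.
  by rewrite eq_sym -[j == _](eqn_add2l #|T|) subnKC // eq_sym; case: eqP.
rewrite h; apply: eq_bigr => u _.
by rewrite -[X in X * _](rmorph_sign polyC) coefCM.
Qed.

End Coverage.

(** * The identity for zero, one and two coordinates *)

Section Points.

Set Implicit Arguments.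
Unset Strict Implicit.

Import GRing.Theory.
Local Open Scope ring_scope.

(** S may be any list containing all the weights of C, so that for a code with few
weights the sums below have few terms. *)
Lemma sum_by_weight (R : nmodType) n (C : code n) (S : seq nat)
    (F : 'rV['F_2]_n -> R) :
  uniq S -> (forall u, u \in C -> wt u \in S) ->
  \sum_(u in C) F u = \sum_(w <- S) \sum_(u in C | wt u == w) F u.
Proof.
move=> uS CS; rewrite [RHS](exchange_big_dep [in C]) /=; last by move=> ? ? _ /andP[].
apply: eq_bigr => u Cu.
rewrite (eq_bigl (pred1 (wt u))) => [|w]; last by rewrite Cu eq_sym.
by rewrite -big_filter filter_pred1_uniq ?CS // big_seq1.
Qed.

Lemma natr_cov (R : pzSemiRingType) n (C : code n) w (T : {set 'I_n}) :
  (cov C w T)%:R = \sum_(u in C | wt u == w) (T \subset supp u)%:R :> R.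
Proof.
rewrite covE -sum1_card natr_sum [RHS]big_mkcond [LHS]big_mkcond /=.
apply: eq_bigr => u _; rewrite inE.
by case: (u \in C); case: (wt u == w); case: (T \subset supp u).
Qed.

Lemma dual_cov0 (R : comNzRingType) n (C : code n) (S : seq nat) j :
  uniq S -> (forall u, u \in C -> wt u \in S) ->
  #|C|%:R * (cov (dual C) j set0)%:R
  = \sum_(w <- S) (cov C w set0)%:R * kraw R (n - w) w j.
Proof.
move=> uS CS; have := dual_cov R C set0 j; rewrite cards0 add0n => ->.
rewrite (sum_by_weight _ uS CS); apply: eq_bigr => w _.
rewrite natr_cov mulr_suml; apply: eq_bigr => u /andP[_ /eqP uw].
rewrite setI0 setU0 setD0 sub0set cards0 !mul1r.
by rewrite cardsCs setCK card_ord -/(wt u) uw.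
Qed.

(** Writing i for the indicator of p in supp u, the summand of dual_cov is affine in
i, and summing it over the words of weight w leaves the counts for the empty
set and for p. *)
Lemma dual_cov1 (R : comNzRingType) n (C : code n) (S : seq nat) p j :
  uniq S -> (forall u, u \in C -> wt u \in S) ->
  #|C|%:R * (cov (dual C) (1 + j) [set p])%:R
  = \sum_(w <- S)
      ((cov C w set0)%:R * kraw R (n - 1 - w) w j
       - (cov C w [set p])%:R *
         (kraw R (n - 1 - w) w j + kraw R (n - w) (w - 1) j)).
Proof.
move=> uS CS; have := dual_cov R C [set p] j; rewrite cards1 => ->.
rewrite (sum_by_weight _ uS CS); apply: eq_bigr => w _.
rewrite !natr_cov !mulr_suml -sumrB; apply: eq_bigr => u /andP[_ /eqP uw].
have cU := cardsC (supp u :|: [set p]); rewrite card_ord setUC cardsU1 in cU.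
have cD := cardsD1 p (supp u); rewrite -/(wt u) uw in cU cD.
rewrite setUC sub0set sub1set setIC -/(wt u).
case: (boolP (p \in supp u)) cU cD => pu cU cD.
  rewrite (setIidPl _) ?sub1set // cards1 !mul1r opprD addNKr expr1 mulN1r.
  by congr (- kraw _ _ _ _); lia.
rewrite (disjoint_setI0 _) ?disjoints1 // cards0 mul0r subr0 !mul1r.
by congr (kraw _ _ _ _); lia.
Qed.

(** As for one point, the summand is now a polynomial in the two indicators of p
and q, and its product term contributes the count for the pair.  The
three Krawtchouk numbers are multiplied in total, up to sign, by the numbers of words that
contain none, one or both of p and q; where a truncated subtraction
underflows, the corresponding number is zero. *)
Lemma dual_cov2 (R : comNzRingType) n (C : code n) (S : seq nat) p q j :
  p != q -> uniq S -> (forall u, u \in C -> wt u \in S) ->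
  #|C|%:R * (cov (dual C) (2 + j) [set p; q])%:R
  = \sum_(w <- S)
      ((cov C w set0)%:R * kraw R (n - 2 - w) w j
       - ((cov C w [set p])%:R + (cov C w [set q])%:R) *
         (kraw R (n - 2 - w) w j + kraw R (n - 1 - w) (w - 1) j)
       + (cov C w [set p; q])%:R *
         (kraw R (n - 2 - w) w j + 2%:R * kraw R (n - 1 - w) (w - 1) j
          + kraw R (n - w) (w - 2) j)).
Proof.
move=> pq uS CS; have := dual_cov R C [set p; q] j; rewrite cards2 pq => ->.
rewrite (sum_by_weight _ uS CS); apply: eq_bigr => w _.
rewrite !natr_cov -big_split !mulr_suml -sumrB -big_split /=.
apply: eq_bigr => u /andP[_ /eqP uw].
have cU := cardsC (supp u :|: [set p; q]); rewrite card_ord in cU.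
have := cardsU (supp u) [set p; q]; rewrite cards2 pq -/(wt u) uw /= => cUI.
have := cardsID [set p; q] (supp u); rewrite -/(wt u) uw => cID.
have cI : #|supp u :&: [set p; q]| = ((p \in supp u) + (q \in supp u))%N.
  rewrite -sum1_card (eq_bigl (fun i => (i \in [set p; q]) && (i \in supp u))).
    rewrite big_mkcondr big_setU1 ?inE //= big_set1 !inE.
    by do 2!case: eqP.
  by move=> i; rewrite inE andbC.
have lw : (#|supp u :&: [set p; q]| <= w)%N by rewrite -cID leq_addr.
rewrite sub0set subUset !sub1set.
move: #|~: _| #|_ :\: _| #|_ :|: _| cI cU cUI cID lw => a b c.
case: (p \in supp u); case: (q \in supp u) => /= -> cU cUI cID lw.
- have [-> ->] : a = (n - w)%N /\ b = (w - 2)%N by lia.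
  rewrite -signr_odd /=; ring.
- have [-> ->] : a = (n - 1 - w)%N /\ b = (w - 1)%N by lia.
  rewrite expr1; ring.
- have [-> ->] : a = (n - 1 - w)%N /\ b = (w - 1)%N by lia.
  rewrite expr1; ring.
have [-> ->] : a = (n - 2 - w)%N /\ b = w by lia.
rewrite expr0; ring.
Qed.

End Points.

(** * Support designs and weight complementation *)

Section Designs.

Set Implicit Arguments.
Unset Strict Implicit.

Import GRing.Theory.
Local Open Scope ring_scope.

Lemma cov_bound n (C : code n) w (T : {set 'I_n}) :
  (w < #|T|)%N -> cov C w T = 0%N.
Proof.
move=> wT; rewrite covE; apply: eq_card0 => u; rewrite !inE.
apply/negP => /and3P[_ /eqP uw /subset_leq_card].
by rewrite -/(wt u) uw leqNgt wT.
Qed.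

Lemma cov_occurs n (C : code n) w : (0 < cov C w set0)%N = occurs C w.
Proof.
rewrite covE card_gt0; apply/set0Pn/existsP => -[u].
  by rewrite inE => /and3P[Cu uw _]; exists u; rewrite Cu.
by case/andP=> Cu uw; exists u; rewrite inE Cu uw sub0set.
Qed.

Lemma cov_nonoccurs n (C : code n) w (T : {set 'I_n}) :
  ~~ occurs C w -> cov C w T = 0%N.
Proof.
rewrite -cov_occurs -eqn0Ngt => /eqP; rewrite !covE => /cards0_eq h.
apply: eq_card0 => u; rewrite !inE; apply/negP => /and3P[Cu uw _].
by have /setP/(_ u) := h; rewrite !inE Cu uw sub0set.
Qed.

Lemma wt_eq0 n (u : 'rV['F_2]_n) : (wt u == 0%N) = (u == 0).
Proof.
rewrite cards_eq0 (_ : set0 = supp (0 : 'rV['F_2]_n)) ?(inj_eq (@supp_inj n)) //.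
by apply/setP => i; rewrite !inE mxE eqxx.
Qed.

Lemma cov00 n (C : code n) : cov C 0 set0 = 1%N.
Proof.
rewrite covE -[RHS](cards1 (0 : 'rV['F_2]_n)); apply: eq_card => u.
rewrite !inE wt_eq0 sub0set andbT; case: eqP => [->|]; last by rewrite andbF.
by rewrite mem0v.
Qed.

Lemma supp_compl n (u : 'rV['F_2]_n) : supp (u + const_mx 1) = ~: supp u.
Proof.
by apply/setP => i; rewrite !inE !mxE; case: (F2_cases (u 0 i)) => ->.
Qed.

Lemma const1_code n (C : code n) : occurs C n -> const_mx 1 \in C.
Proof.
case/existsP=> u /andP[Cu un]; suff <- : u = const_mx 1 by [].
apply: (@supp_inj n); rewrite -[const_mx 1]add0r supp_compl.
rewrite (_ : supp 0 = set0) ?setC0; last first.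
  by apply/setP => i; rewrite !inE mxE eqxx.
by apply/eqP; rewrite eqEcard subsetT cardsT card_ord -/(wt u) (eqP un) leqnn.
Qed.

Section Complement.

Variables (n : nat) (C : code n) (w w' : nat).
Hypotheses (C1 : const_mx 1 \in C) (ww' : (w + w' = n)%N).

Lemma natr_cov_compl (R : pzSemiRingType) (T : {set 'I_n}) :
  (cov C w' T)%:R = \sum_(u in C | wt u == w) (T \subset ~: supp u)%:R :> R.
Proof.
rewrite natr_cov (reindex (fun u => u + const_mx 1)) /=; last first.
  by exists (fun u => u - const_mx 1) => u _; rewrite ?addrK ?subrK.
apply: eq_big => [u|u _]; last by rewrite supp_compl.
rewrite rpredDr // /wt supp_compl; congr (_ && _).
have := cardsC (supp u); rewrite card_ord; lia.
Qed.

Lemma cov_compl0 : cov C w' set0 = cov C w set0.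
Proof.
suff : (cov C w' set0)%:R = (cov C w set0)%:R :> Z by lia.
by rewrite natr_cov_compl natr_cov; apply: eq_bigr => u _; rewrite !sub0set.
Qed.

Lemma cov_compl1 p : (cov C w' [set p] + cov C w [set p] = cov C w set0)%N.
Proof.
suff : (cov C w' [set p])%:R + (cov C w [set p])%:R = (cov C w set0)%:R :> Z.
  by lia.
rewrite natr_cov_compl !natr_cov -big_split.
by apply: eq_bigr => u _; rewrite !sub1set sub0set inE; case: (p \in _).
Qed.

Lemma cov_compl2 p q :
  (cov C w' [set p; q] + cov C w [set p] + cov C w [set q]
   = cov C w set0 + cov C w [set p; q])%N.
Proof.
suff : (cov C w' [set p; q])%:R + (cov C w [set p])%:R + (cov C w [set q])%:R
    = (cov C w set0)%:R + (cov C w [set p; q])%:R :> Z by lia.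
rewrite natr_cov_compl !natr_cov -!big_split /=.
apply: eq_bigr => u _; rewrite !subUset !sub1set sub0set !in_setC.
by case: (p \in supp u); case: (q \in supp u).
Qed.

End Complement.

Lemma cov_full n (C : code n) (T : {set 'I_n}) :
  const_mx 1 \in C -> cov C n T = 1%N.
Proof.
move=> C1; suff : (cov C n T)%:R = 1 :> Z by lia.
rewrite (natr_cov_compl C1 (add0n n)) (big_pred1 0) => [|u].
  rewrite (_ : supp 0 = set0) ?setC0 ?subsetT //.
  by apply/setP => i; rewrite !inE mxE eqxx.
by rewrite wt_eq0 /=; case: (u =P 0) => [->|]; rewrite ?mem0v ?andbF.
Qed.

Lemma dot_const1 n (v : 'rV['F_2]_n) : dot v (const_mx 1) = (odd (wt v))%:R.
Proof.
have natF2 m : m%:R = (odd m)%:R :> 'F_2.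
  elim: m => // m IH; rewrite mulrSr IH /=.
  by case: (odd m); apply: val_inj.
rewrite -natF2 /wt -sum1_card natr_sum [RHS]big_mkcond; apply: eq_bigr => i _.
by rewrite mxE mulr1 inE; case: (F2_cases (v 0 i)) => ->.
Qed.

(** Orthogonality to the all-one word is evenness of the weight. *)
Lemma dual_weights_even n (C : code n) w :
  const_mx 1 \in C -> occurs (dual C) w -> ~~ odd w.
Proof.
move=> C1 /existsP[v /andP[/mem_dual v_dual /eqP <-]].
have := v_dual _ C1; rewrite -/(dot v _) dot_const1.
by case: (odd _) => // /eqP; rewrite oner_eq0.
Qed.

Lemma const1_dual n (C : code n) :
  (forall u, u \in C -> ~~ odd (wt u)) -> const_mx 1 \in dual C.
Proof.
move=> C_even; apply/mem_dual => u Cu.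
under eq_bigr => i _ do rewrite mulrC.
by rewrite -/(dot u _) dot_const1 (negbTE (C_even u Cu)).
Qed.

(** With no t-subset at all (t > n) the design condition is void, and lambda = 0
is a witness. *)
Lemma t_designP n (C : code n) t w :
  is_t_design t (support_design C w) <->
  (forall S S' : {set 'I_n}, #|S| = t -> #|S'| = t -> cov C w S = cov C w S').
Proof.
split=> [[v [k [l [_ _ h]]]] S S' St S't|h].
  by rewrite /cov !h.
exists n, w; have [S0 /eqP S0t|noS] := pickP [pred S : {set 'I_n} | #|S| == t].
  exists (cov C w S0); split; rewrite ?card_ord //.
    by move=> b /imsetP[u]; rewrite inE => /andP[_ /eqP <-] ->.
  by move=> S St; rewrite -(h S S0).
exists 0%N; split; rewrite ?card_ord //.
  by move=> b /imsetP[u]; rewrite inE => /andP[_ /eqP <-] ->.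
by move=> S St; have := noS S; rewrite /= St eqxx.
Qed.

Lemma pair_designP n (C : code n) w :
  is_t_design 2 (support_design C w) <->
  (forall p q r s, p != q -> r != s ->
     cov C w [set p; q] = cov C w [set r; s]).
Proof.
split=> [/t_designP h p q r s pq rs|h].
  by apply: h; rewrite cards2 ?pq ?rs.
apply/t_designP => S S' /eqP/cards2P[p [q [pq ->]]] /eqP/cards2P[r [s [rs ->]]].
exact: h.
Qed.

(** Double counting of the pairs (t-subset, block containing it), with falling
factorials in place of binomial coefficients to keep the numbers linear in small
products. *)
Lemma t_design_count n (C : code n) t w (S : {set 'I_n}) :
  is_t_design t (support_design C w) -> #|S| = t ->
  (cov C w set0 * w ^_ t = cov C w S * n ^_ t)%N.
Proof.
move=> /t_designP h St; rewrite -!bin_ffact !mulnA; congr (_ * _)%N.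
(* Both sides count the pairs (X, b) with X a t-subset of the block b. *)
have -> : (cov C w set0 * 'C(w, t)
    = \sum_(b in support_design C w) \sum_(X : {set 'I_n} | (X \subset b) && (#|X| == t)) 1)%N.
  rewrite (eq_bigr (fun=> 'C(w, t))) => [|b /imsetP[u]].
    rewrite sum_nat_const; congr (_ * _)%N; apply: eq_card => b.
    by rewrite inE sub0set andbT.
  rewrite inE => /andP[_ /eqP uw] ->.
  rewrite sum1dep_card -[in RHS]uw -cards_draws; apply: eq_card => X.
  by rewrite !inE.
rewrite (exchange_big_dep (fun X : {set 'I_n} => #|X| == t)) /=; last first.
  by move=> b X _ /andP[].
rewrite (eq_bigr (fun=> cov C w S)) => [|X /eqP Xt].
  rewrite sum_nat_const mulnC; congr (_ * _)%N.
  rewrite -[in RHS](card_ord n) -card_draws.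
  by apply: eq_card => X; rewrite !inE.
rewrite -(h X S) // /cov -sum1_card; apply: eq_bigl => b.
by rewrite inE Xt eqxx andbT.
Qed.

(** Equivalent to every support design being a 1-design; equality of counts is the
form in which the property enters the pair identities. *)
Definition point_regular n (C : code n) :=
  forall w p q, cov C w [set p] = cov C w [set q].

Lemma point_regular_design n (C : code n) w :
  point_regular C -> is_t_design 1 (support_design C w).
Proof.
move=> h; apply/t_designP => S S' /eqP/cards1P[p ->] /eqP/cards1P[q ->].
exact: h.
Qed.

Lemma code_neq0 n (C : code n) : #|C|%:R != 0 :> Z.
Proof.
have : (0 < #|C|)%N by apply/card_gt0P; exists 0; apply: mem0v.
lia.
Qed.

Lemma wt_iota n (u : 'rV['F_2]_n) : wt u \in iota 0 n.+1.
Proof. by rewrite mem_iota add0n ltnS leq0n /wt -[X in (_ <= X)%N](card_ord n) max_card. Qed.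

(** The right-hand side of dual_cov1 depends on p only through the one-point counts
of C. *)
Lemma point_regular_dual n (C : code n) :
  point_regular C -> point_regular (dual C).
Proof.
move=> h [|j] p q; first by rewrite !cov_bound ?cards1.
have CS u (_ : u \in C) : wt u \in iota 0 n.+1 := wt_iota u.
have e i := dual_cov1 Z i j (iota_uniq 0 n.+1) CS.
have := e p; under eq_bigr => w _ do rewrite (h w p q).
by rewrite -e add1n => /(mulfI (code_neq0 C)); lia.
Qed.

(** For 2 <= w <= n - 2 this equals 4 * kraw (n - 2 - w) (w - 2) j, since
(1 - y)^2 + 2 (1 - y) (1 + y) + (1 + y)^2 = 4. *)
Definition pair_kernel n w j : Z :=
  (kraw Z (n - 2 - w) w j + 2 * kraw Z (n - 1 - w) (w - 1) j
   + kraw Z (n - w) (w - 2) j)%R.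

(** For a point regular code these differences play the part of the coefficients of
harmonic weight enumerators of degree 2: they all vanish at w exactly when the
design of weight w is a 2-design. *)
Definition pair_diff n (C : code n) w p q r s : Z :=
  ((cov C w [set p; q])%:R - (cov C w [set r; s])%:R)%R.

(** In dual_cov2 the terms that do not involve the count of the pair are the same
for all pairs once C is point regular, and disappear from the difference. *)
Lemma pair_diff_dual n (C : code n) (S : seq nat) p q r s j :
  point_regular C -> uniq S -> (forall u, u \in C -> wt u \in S) ->
  p != q -> r != s ->
  #|C|%:R * pair_diff (dual C) (2 + j) p q r s
  = \sum_(w <- S) pair_diff C w p q r s * pair_kernel n w j.
Proof.
move=> h uS CS pq rs; rewrite mulrBr (dual_cov2 _ _ pq uS CS).
rewrite (dual_cov2 _ _ rs uS CS) -sumrB; apply: eq_bigr => w _.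
rewrite /pair_diff /pair_kernel (h w q p) (h w r p) (h w s p); ring.
Qed.

(** Multiplication by 1 + c X on lists of coefficients, prev being the coefficient
that precedes the list. *)
Fixpoint shift_add (R : comNzRingType) (c prev : R) (l : seq R) : seq R :=
  if l is x :: l' then x + c * prev :: shift_add c x l' else [:: c * prev].

(** The coefficients of (1 + X)^a (1 - X)^b in a form that the virtual machine
evaluates, so that Krawtchouk numbers become integer literals. *)
Definition kraw_list (R : comNzRingType) (a b : nat) : seq R :=
  iter a (shift_add 1 0) (iter b (shift_add (-1) 0) [:: 1]).

Lemma Poly_shift_add (R : comNzRingType) (c prev : R) (l : seq R) :
  Poly (shift_add c prev l) = (1 + c *: 'X) * Poly l + (c * prev)%:P.
Proof.
elim: l prev => [|x l IH] prev /=.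
  by rewrite !cons_poly_def mul0r mulr0 !add0r.
rewrite !cons_poly_def IH -!mul_polyC !rmorphD !rmorphM /=.
ring.
Qed.

Lemma krawE (R : comNzRingType) a b j : kraw R a b j = nth 0 (kraw_list R a b) j.
Proof.
rewrite /kraw -[RHS]coef_Poly; congr (nth _ (polyseq _) _).
rewrite /kraw_list; elim: a => [|a IH] /=.
  rewrite expr0 mul1r; elim: b => [|b IH] /=.
    by rewrite cons_poly_def mul0r add0r.
  by rewrite exprS IH Poly_shift_add mulr0 addr0 scaleN1r.
by rewrite exprS -mulrA IH Poly_shift_add mulr0 addr0 scale1r.
Qed.

End Designs.

(** * The two families *)

Ltac eval_kraw :=
  rewrite !krawE;
  repeat match goal with |- context [nth ?z (kraw_list ?R ?a ?b) ?j] =>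
    let v := eval vm_compute in (nth z (kraw_list R a b) j) in
    rewrite (_ : nth z (kraw_list R a b) j = v); [| by vm_compute]
  end.

Section Families.

Set Implicit Arguments.
Unset Strict Implicit.

Import Order.TTheory GRing.Theory Num.Theory.
Local Open Scope ring_scope.

Lemma wt_spectrum n (C : code n) (S : seq nat) :
  (forall w, occurs C w = (w \in S)) -> forall u, u \in C -> wt u \in S.
Proof. by move=> h u Cu; rewrite -h; apply/existsP; exists u; rewrite Cu eqxx. Qed.

Lemma cov_min_weight n (C : code n) d w (T : {set 'I_n}) :
  has_min_weight C d -> (0 < w < d)%N -> cov C w T = 0%N.
Proof.
case=> _ h /andP[w0 wd]; apply: cov_nonoccurs; apply/existsP => -[u /andP[Cu /eqP uw]].
have := h u Cu; rewrite -wt_eq0 uw -lt0n w0 => /(_ isT); lia.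
Qed.

Definition familyA_kernel j :=
  pair_kernel 48 16 j - 2 * pair_kernel 48 24 j + pair_kernel 48 32 j.

(** These are the weights 2 + j = 6 and 42.  The vanishing at j = 4 comes from the
coefficients of y^2 and y^4 in (1 + y)^16 + (1 - y)^16 - 2 (1 - y^2)^8, which
are 256 and 3584 = 14 * 256: the factor (1 - y^2)^14 contributes - 14 * 256.
The case j = 40 is the mirror image under j -> 44 - j. *)
Lemma familyA_kernel_eq0 j : j = 4%N \/ j = 40%N -> familyA_kernel j = 0.
Proof. by rewrite /familyA_kernel /pair_kernel !krawE; case=> ->; vm_compute. Qed.

Lemma familyA_kernel_neq0 j :
  (j <= 44)%N -> ~~ odd j -> j \notin [:: 0; 4; 40; 44]%N -> familyA_kernel j != 0.
Proof.
rewrite -ltnS => j45.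
suff /allP/(_ j) : all (fun i => ~~ odd i ==> (i \notin [:: 0; 4; 40; 44]%N)
                        ==> (familyA_kernel i != 0)) (iota 0 45).
  by rewrite mem_iota j45 => /(_ isT)/implyP h1 /h1/implyP.
under eq_all => i do rewrite /familyA_kernel /pair_kernel !krawE.
by vm_compute.
Qed.

Lemma familyB_kernel_neq0 j : (j <= 44)%N -> ~~ odd j -> pair_kernel 48 24 j != 0.
Proof.
rewrite -ltnS => j45.
suff /allP/(_ j) : all (fun i => ~~ odd i ==> (pair_kernel 48 24 i != 0)) (iota 0 45).
  by rewrite mem_iota j45 => /(_ isT)/implyP.
under eq_all => i do rewrite /pair_kernel !krawE.
by vm_compute.
Qed.

Section FamilyA.

Variable C : code 48.
Hypothesis CA : familyA C.

Let SA : seq nat := [:: 0; 16; 24; 32; 48]%N.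

Lemma familyA_spectrum u : u \in C -> wt u \in SA.
Proof. by case: CA => _ h _; apply: wt_spectrum. Qed.

Lemma familyA_const1 : const_mx 1 \in C.
Proof. by case: CA => _ h _; apply: const1_code; rewrite h. Qed.

Lemma familyA_dual_count j :
  #|C|%:R * (cov (dual C) j set0)%:R
  = kraw Z 48 0 j + kraw Z 0 48 j
    + (cov C 16 set0)%:R * (kraw Z 32 16 j + kraw Z 16 32 j)
    + (cov C 24 set0)%:R * kraw Z 24 24 j.
Proof.
rewrite (@dual_cov0 _ _ _ SA) //;
  last exact: familyA_spectrum.
rewrite !big_cons big_nil cov00 (cov_full _ familyA_const1).
rewrite (cov_compl0 familyA_const1 (erefl : (16 + 32 = 48)%N)).
rewrite /=; ring.
Qed.

Lemma familyA_size :
  #|C|%:R = 2%:R + 2%:R * (cov C 16 set0)%:R + (cov C 24 set0)%:R :> Z.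
Proof.
have := familyA_dual_count 0; rewrite cov00; eval_kraw; lia.
Qed.

(** This is the statement that the dual code has no word of weight 2. *)
Lemma familyA_count16 :
  32%:R * (cov C 16 set0)%:R = 3%:R * #|C|%:R - 288%:R :> Z.
Proof.
have := familyA_dual_count 2; case: CA => _ _ dmin.
rewrite (cov_min_weight _ dmin) //; have := familyA_size; eval_kraw; lia.
Qed.

Lemma familyA_dual_count6 :
  #|C|%:R * (cov (dual C) 6 set0)%:R = 3008 * (8192 - #|C|%:R) :> Z.
Proof.
have := familyA_dual_count 6.
have := familyA_size; have := familyA_count16; eval_kraw; lia.
Qed.

Lemma familyA_dual_const1 : const_mx 1 \in dual C.
Proof.
apply: const1_dual => u /familyA_spectrum.
by rewrite !inE => /or4P[|||/orP[]] /eqP ->.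
Qed.

Lemma familyA_dual_count42 : cov (dual C) 42 set0 = cov (dual C) 6 set0.
Proof. exact: (cov_compl0 familyA_dual_const1 (erefl : (6 + 42 = 48)%N)). Qed.

Lemma familyA_dual_weights w :
  (0 < w < 48)%N -> occurs (dual C) w -> (4 <= w <= 44)%N && ~~ odd w.
Proof.
move=> w48 wC; have w_even := dual_weights_even familyA_const1 wC.
have c2 : cov (dual C) 2 set0 = 0%N.
  by have [_ _ dmin] := CA; rewrite (cov_min_weight _ dmin).
have c46 := cov_compl0 familyA_dual_const1 (erefl : (2 + 46 = 48)%N).
move: wC; rewrite -cov_occurs.
case: (w =P 2) => [->|w2]; first by rewrite c2.
case: (w =P 46) => [->|w46]; first by rewrite c46 c2.
by move=> _; lia.
Qed.

Lemma familyA_card : #|C|%:R = 2 ^+ \dim C :> Z.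
Proof. by rewrite (@card_vspace _ _ _ C) card_Fp // natrX. Qed.

(** A word of weight 16 exists, so 3 |C| > 288; the number of dual words of weight 6
is not negative, so |C| <= 8192. *)
Lemma familyA_dim : (7 <= \dim C <= 13)%N.
Proof.
have := familyA_dual_count6; have := familyA_count16.
have : (0 < cov C 16 set0)%N by rewrite cov_occurs; case: CA => _ ->.
rewrite familyA_card => a_gt0 a_eq b_eq.
have dim_le m n : (m <= n)%N -> 2 ^+ m <= 2 ^+ n :> Z by apply: ler_weXn2l.
have [lo|/dim_le lo] := leqP 7 (\dim C); last by rewrite exprS in lo; lia.
have [//|/dim_le hi] := leqP (\dim C) 13.
nia.
Qed.

(** A 2-design needs 16 * 15 * a = 48 * 47 * lambda, so 47 divides a.  With
a = 3 * 2^(k - 5) - 9 this fails for 7 <= k <= 13. *)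
Lemma familyA_not_2_design16 : ~ is_t_design 2 (support_design C 16).
Proof.
pose S2 : {set 'I_48} := [set ord0; ord_max].
have cS2 : #|S2| = 2 by rewrite cards2.
move=> /t_design_count/(_ cS2); rewrite !ffactnS !ffactn0 /=.
have := familyA_count16; rewrite familyA_card.
have : \dim C \in iota 7 7 by rewrite mem_iota familyA_dim.
rewrite !inE => /or4P[||| /or4P[]] /eqP ->; lia.
Qed.

(** The number of blocks is 3008 (2^(13 - k) - 1), and 3008 = 64 * 47.  A 3-design
would need 23, a divisor of 48 * 47 * 46, to divide 2^(13 - k) - 1, which fails
for 7 <= k <= 12. *)
Lemma familyA_dual_not_3_design w : w = 6%N \/ w = 42%N ->
  \dim C <> 13%N -> ~ is_t_design 3 (support_design (dual C) w).
Proof.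
move=> w642 dimC; pose S3 : {set 'I_48} := [set ord0; inord 1; inord 2].
have cS3 : #|S3| = 3.
  by rewrite /S3 setUC cardsU1 cards2 !inE -!val_eqE /= !inordK.
move=> /t_design_count/(_ cS3).
have [Bw w3] : cov (dual C) w set0 = cov (dual C) 6 set0
    /\ (w ^_ 3 = 120 \/ w ^_ 3 = 42 * 41 * 40)%N.
  by case: w642 => ->; rewrite ?familyA_dual_count42 !ffactnS ffactn0; lia.
rewrite Bw (_ : 48 ^_ 3 = 48 * 47 * 46)%N; last by rewrite !ffactnS ffactn0.
have := familyA_dual_count6; rewrite familyA_card.
have : \dim C \in iota 7 6 by rewrite mem_iota; have := familyA_dim; lia.
rewrite !inE => /or4P[||| /or3P[]] /eqP ->; lia.
Qed.

(** No dual word of weight 2 passes through p; together with complementation this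
determines the number of words of weight 16 through p. *)
Lemma familyA_point16 p : (3 * cov C 16 [set p] = cov C 16 set0)%N.
Proof.
have := @dual_cov1 Z _ C SA p 1 isT familyA_spectrum.
have c0 : cov C 0 [set p] = 0%N by rewrite cov_bound ?cards1.
have c32 := cov_compl1 familyA_const1 (erefl : (16 + 32 = 48)%N) p.
have c24 := cov_compl1 familyA_const1 (erefl : (24 + 24 = 48)%N) p.
have := familyA_size; have := familyA_count16.
have b32 := cov_compl0 familyA_const1 (erefl : (16 + 32 = 48)%N).
case: CA => _ _ dmin; rewrite (cov_min_weight _ dmin) //.
rewrite !big_cons big_nil !(cov_full _ familyA_const1) cov00 c0; eval_kraw.
lia.
Qed.

Lemma familyA_point_regular : point_regular C.
Proof.
move=> w p q; have [wC|/cov_nonoccurs h] := boolP (occurs C w); last by rewrite !h.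
have [_ spec _] := CA; move: wC; rewrite spec !inE.
have eq16 : cov C 16 [set p] = cov C 16 [set q].
  by have := familyA_point16 p; have := familyA_point16 q; lia.
case/or4P => [|||/orP[]] /eqP ->.
- by rewrite !cov_bound ?cards1.
- exact: eq16.
- have := cov_compl1 familyA_const1 (erefl : (24 + 24 = 48)%N) p.
  have := cov_compl1 familyA_const1 (erefl : (24 + 24 = 48)%N) q.
  by lia.
- have := cov_compl1 familyA_const1 (erefl : (16 + 32 = 48)%N) p.
  have := cov_compl1 familyA_const1 (erefl : (16 + 32 = 48)%N) q.
  by lia.
by rewrite !(cov_full _ familyA_const1).
Qed.

Section Pairs.

Variables p q r s : 'I_48.
Hypotheses (pq : p != q) (rs : r != s).

Lemma familyA_diff32 : pair_diff C 32 p q r s = pair_diff C 16 p q r s.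
Proof.
have := cov_compl2 familyA_const1 (erefl : (16 + 32 = 48)%N) p q.
have := cov_compl2 familyA_const1 (erefl : (16 + 32 = 48)%N) r s.
have := familyA_point_regular 16%N p r; have := familyA_point_regular 16%N q s.
by rewrite /pair_diff; lia.
Qed.

Lemma familyA_pair_diff_dual_sum j :
  #|C|%:R * pair_diff (dual C) (2 + j) p q r s
  = pair_diff C 16 p q r s * (pair_kernel 48 16 j + pair_kernel 48 32 j)
    + pair_diff C 24 p q r s * pair_kernel 48 24 j.
Proof.
rewrite (pair_diff_dual _ familyA_point_regular (S := SA)) //;
  last exact: familyA_spectrum.
rewrite !big_cons big_nil familyA_diff32.
(* The differences at weights 0 and 48 are zero. *)
rewrite {1 5}/pair_diff !(cov_full _ familyA_const1) !cov_bound ?cards2 ?pq ?rs //; ring.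
Qed.

(** No dual word of weight 2 contains a pair, and every kernel value at j = 0
is 4. *)
Lemma familyA_diff24 : pair_diff C 24 p q r s = - (2 * pair_diff C 16 p q r s).
Proof.
have := familyA_pair_diff_dual_sum 0; rewrite {1}/pair_diff /pair_kernel.
case: CA => _ _ dmin; rewrite !(cov_min_weight _ dmin) //; eval_kraw; lia.
Qed.

Lemma familyA_pair_diff_dual j :
  #|C|%:R * pair_diff (dual C) (2 + j) p q r s
  = pair_diff C 16 p q r s * familyA_kernel j.
Proof.
rewrite familyA_pair_diff_dual_sum familyA_diff24 /familyA_kernel; ring.
Qed.

End Pairs.

(** For |C| = 8192 the factor 8192 - |C| in the number of dual words of weight 6
vanishes. *)
Lemma familyA_dual_dim13 w : w = 6%N \/ w = 42%N ->
  \dim C = 13%N -> ~~ occurs (dual C) w.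
Proof.
move=> w642 dim13; have := familyA_dual_count6; have := code_neq0 C.
rewrite familyA_card dim13 -cov_occurs => _ B6.
suff -> : cov (dual C) w set0 = cov (dual C) 6 set0 by lia.
by case: w642 => -> //; apply: familyA_dual_count42.
Qed.

Lemma familyA_dual_2_design w : w = 6%N \/ w = 42%N ->
  is_t_design 2 (support_design (dual C) w).
Proof.
move=> w642; have [j -> j0] : exists2 j, w = (2 + j)%N & familyA_kernel j = 0.
  by case: w642 => ->; [exists 4%N|exists 40%N] => //; apply: familyA_kernel_eq0; auto.
apply/pair_designP => p q r s pq rs; have := familyA_pair_diff_dual pq rs j.
rewrite j0 mulr0 => /eqP; rewrite mulf_eq0 (negbTE (code_neq0 C)) /pair_diff /=; lia.
Qed.

Lemma familyA_not_2_design w : (0 < w < 48)%N -> occurs C w ->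
  ~ is_t_design 2 (support_design C w).
Proof.
move=> w48 wC /pair_designP h; apply: familyA_not_2_design16.
apply/pair_designP => p q r s pq rs.
have := familyA_diff32 pq rs; have := familyA_diff24 pq rs; rewrite /pair_diff.
have [_ spec _] := CA; have := h p q r s pq rs; move: wC; rewrite spec !inE.
case/or4P => [|||/orP[]] /eqP ew; move: w48; rewrite ew //; lia.
Qed.

(** Where the kernel does not vanish, a 2-design in the dual makes every pair
difference of weight 16 zero. *)
Lemma familyA_dual_not_2_design w : (0 < w < 48)%N -> occurs (dual C) w ->
  w <> 6%N -> w <> 42%N -> ~ is_t_design 2 (support_design (dual C) w).
Proof.
move=> w48 wC w6 w42; have /andP[w444 w_even] := familyA_dual_weights w48 wC.
have [j ew] : exists j, w = (2 + j)%N by exists (w - 2)%N; lia.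
have kj : familyA_kernel j != 0.
  by apply: familyA_kernel_neq0; rewrite ?inE ?negb_or; lia.
rewrite ew => /pair_designP h; apply: familyA_not_2_design16.
apply/pair_designP => p q r s pq rs; have /esym/eqP := familyA_pair_diff_dual pq rs j.
rewrite (_ : pair_diff (dual C) _ _ _ _ _ = 0); last first.
  by rewrite /pair_diff (h p q r s) // subrr.
rewrite mulr0 mulf_eq0 (negbTE kj) orbF.
by rewrite /pair_diff; lia.
Qed.

End FamilyA.

Section FamilyB.

Variable C : code 48.
Hypothesis CB : familyB C.

Let SB : seq nat := [:: 0; 24; 48]%N.

Lemma familyB_spectrum u : u \in C -> wt u \in SB.
Proof. by case: CB => _ h _; apply: wt_spectrum. Qed.

Lemma familyB_const1 : const_mx 1 \in C.
Proof. by case: CB => _ h _; apply: const1_code; rewrite h. Qed.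

Lemma familyB_point_regular : point_regular C.
Proof.
move=> w p q; have [wC|/cov_nonoccurs h] := boolP (occurs C w); last by rewrite !h.
have [_ spec _] := CB; move: wC; rewrite spec !inE.
case/or3P => /eqP ->.
- by rewrite !cov_bound ?cards1.
- have := cov_compl1 familyB_const1 (erefl : (24 + 24 = 48)%N) p.
  by have := cov_compl1 familyB_const1 (erefl : (24 + 24 = 48)%N) q; lia.
by rewrite !(cov_full _ familyB_const1).
Qed.

(** A 2-design with b blocks satisfies 23 b = 94 lambda, so b >= 94; but a dual
word of weight 2 exists, and |C| times the number of these is 2256 - 24 b > 0. *)
Lemma familyB_not_2_design24 : ~ is_t_design 2 (support_design C 24).
Proof.
pose S2 : {set 'I_48} := [set ord0; ord_max].
have cS2 : #|S2| = 2 by rewrite cards2.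
move=> /t_design_count/(_ cS2); rewrite !ffactnS !ffactn0 /=.
have : (0 < cov C 24 set0)%N by rewrite cov_occurs; case: CB => _ ->.
have : (0 < cov (dual C) 2 set0)%N.
  case: CB => _ _ [[x [Cx _ /eqP x2]] _].
  by rewrite cov_occurs; apply/existsP; exists x; rewrite Cx.
have := dual_cov0 Z 2 (isT : uniq SB) familyB_spectrum.
rewrite !big_cons big_nil cov00 (cov_full _ familyB_const1); eval_kraw.
have := code_neq0 C; nia.
Qed.

Lemma familyB_pair_diff_dual p q r s j : p != q -> r != s ->
  #|C|%:R * pair_diff (dual C) (2 + j) p q r s
  = pair_diff C 24 p q r s * pair_kernel 48 24 j.
Proof.
move=> pq rs.
rewrite (pair_diff_dual _ familyB_point_regular (S := SB)) //;
  last exact: familyB_spectrum.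
rewrite !big_cons big_nil.
(* The differences at weights 0 and 48 are zero. *)
rewrite {1 3}/pair_diff !(cov_full _ familyB_const1) !cov_bound ?cards2 ?pq ?rs //; ring.
Qed.

Lemma familyB_not_2_design w : (0 < w < 48)%N -> occurs C w ->
  ~ is_t_design 2 (support_design C w).
Proof.
have [_ spec _] := CB; move=> w48; rewrite spec !inE.
case/or3P => /eqP ew; move: w48; rewrite ew // => _.
exact: familyB_not_2_design24.
Qed.

Lemma familyB_dual_not_2_design w : (0 < w < 48)%N -> occurs (dual C) w ->
  ~ is_t_design 2 (support_design (dual C) w).
Proof.
move=> w48 wC; have w_even := dual_weights_even familyB_const1 wC.
have [j ew] : exists j, w = (2 + j)%N by exists (w - 2)%N; lia.
have kj : pair_kernel 48 24 j != 0 by apply: familyB_kernel_neq0; lia.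
rewrite ew => /pair_designP h; apply: familyB_not_2_design24.
apply/pair_designP => p q r s pq rs; have /esym/eqP := familyB_pair_diff_dual j pq rs.
rewrite (_ : pair_diff (dual C) _ _ _ _ _ = 0); last first.
  by rewrite /pair_diff (h p q r s) // subrr.
rewrite mulr0 mulf_eq0 (negbTE kj) orbF.
by rewrite /pair_diff; lia.
Qed.

End FamilyB.

End Families.

Theorem theorem4p4 (C : {vspace 'rV['F_2]_48}) (hC : familyA C \/ familyB C) :
  [/\ (forall w : nat, w <> 0 ->
         (occurs C w -> is_t_design 1 (support_design C w)) /\
         (occurs (dual C) w -> is_t_design 1 (support_design (dual C) w))),
      (familyA C -> \dim C <> 13 ->
         [/\ is_t_design 2 (support_design (dual C) 6),
             ~ is_t_design 3 (support_design (dual C) 6),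
             is_t_design 2 (support_design (dual C) 42)
           & ~ is_t_design 3 (support_design (dual C) 42)])
    & (forall w : nat, 0 < w -> w < 48 ->
         (occurs C w -> ~ is_t_design 2 (support_design C w)) /\
         (occurs (dual C) w ->
          ~ (familyA C /\ \dim C <> 13 /\ (w = 6 \/ w = 42)) ->
          ~ is_t_design 2 (support_design (dual C) w)))].
Proof.
have regular : point_regular C.
  case: hC => [CA|CB]; first exact: familyA_point_regular.
  exact: familyB_point_regular.
split=> [w _|CA dimC|w w_gt0 w48].
- by split=> _; apply: point_regular_design => //; apply: point_regular_dual.
- by split; [apply: familyA_dual_2_design|apply: familyA_dual_not_3_design
    |apply: familyA_dual_2_design|apply: familyA_dual_not_3_design]; auto.
have w_range : 0 < w < 48 by rewrite w_gt0.
case: hC => [CA|CB]; split=> wC.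
- exact: familyA_not_2_design.
- move=> exception.
  have [w642|w642] := boolP ((w == 6) || (w == 42)).
    have {}w642 : w = 6 \/ w = 42 by move/orP: w642 => [/eqP|/eqP]; auto.
    have [dim13|dimC] := \dim C =P 13.
      by have := familyA_dual_dim13 CA w642 dim13; rewrite wC.
    by case: exception.
  by apply: familyA_dual_not_2_design => //; lia.
- exact: familyB_not_2_design.
by move=> _; apply: familyB_dual_not_2_design.
Qed.
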